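(* Let $X$ be a Peano continuum with a given (possibly non-geodesic) metric inducing its topology, and let $\varepsilon>0$. Then $NC(\varepsilon)<\infty$, where $NC(\varepsilon)$ is the number of equivalence classes of entourage covers $\phi_E:X_E\to X$ (with $E$ a chained entourage) such that $\sigma(E)\ge\varepsilon$, $\sigma$ being computed in the given metric.
   Context: A Peano continuum is a compact, connected, locally path connected (metrizable) space. An entourage in a metric space $X$ is a symmetric subset $E\subset X\times X$ containing $E_\varepsilon:=\{(x,y):d(x,y)<\varepsilon\}$ for some $\varepsilon>0$. $B(x,E):=\{y:(x,y)\in E\}$. An $E$-chain is a finite sequence $\{x_0,\dots,x_n\}$ with $(x_i,x_{i+1})\in E$ for all $i$. An $E$-homotopy between $E$-chains is a finite sequence of $E$-chains with the same endpoints, each obtained from the previous one by inserting or removing a single point (never an endpoint), every step remaining an $E$-chain; $[\alpha]_E$ is the $E$-homotopy class of $\alpha$ (a chain $\{x,x\}$ is identified with $\{x\}$). Concatenation is $\ast$, reversal is $\overline{\alpha}$. $E$ is chained if $E$ is contained in the closure of its interior and whenever $(x,y)\in E$ and $F$ is an entourage, $x,y$ can be joined by an $F$-chain lying in $B(x,E)\cap B(y,E)$. Fix a basepoint $\ast\in X$. $X_E$ is the set of classes $[\alpha]_E$ of $E$-chains starting at $\ast$, and $\phi_E:X_E\to X$ sends $[\alpha]_E$ to the endpoint of $\alpha$. For an entourage $F\subset E$, $F^\ast$ is the set of pairs $([\alpha]_E,[\beta]_E)$ with endpoints $x,y$ such that $(x,y)\in F$ and $[\overline{\alpha}\ast\beta]_E=[\{x,y\}]_E$;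 the balls $B(\cdot,F^\ast)$ form a basis of the topology of $X_E$, for which $\phi_E$ is a regular covering map. An entourage cover is a $\phi_E$ with $E$ chained. Two covers of $X$ are equivalent if there is a homeomorphism between the total spaces commuting with the projections to $X$. $\sigma(E):=\sup\{\varepsilon>0:E_\varepsilon\subset E\}$. *)

(* Defs.v *)
(* MathComp-Analysis: metric spaces are metricType R over an arbitrary
   R : realType. *)
From HB Require Import structures.
From mathcomp Require Import all_boot all_order all_algebra generic_quotient.
From mathcomp Require Import boolp classical_sets functions cardinality reals.
From mathcomp Require Import ereal topology normedtype counting_measure.

Set Implicit Arguments.
Unset Strict Implicit.
Unset Printing Implicit Defensive.
Import Order.TTheory GRing.Theory Num.Theory.
Import numFieldNormedType.Exports.

Local Open Scope classical_set_scope.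
Local Open Scope ring_scope.
Local Open Scope quotient_scope.

Section peano.
Context {R : realType} (T : topologicalType).

Definition path_connected (A : set T) :=
  forall x y, A x -> A y -> exists g : R -> T,
    [/\ {within `[0, 1], continuous g}, g 0 = x, g 1 = y &
        g @` `[0, 1] `<=` A].

Definition locally_path_connected :=
  forall (x : T) (U : set T), nbhs x U ->
    exists V, [/\ open V, V x, V `<=` U & path_connected V].

(* Metrizability is not repeated here: the theorem is about a metricType. *)
Definition peano_continuum :=
  [/\ compact [set: T], connected [set: T] & locally_path_connected].

End peano.
Arguments path_connected R {T} A.
Arguments locally_path_connected R T : clear implicits.
Arguments peano_continuum R T : clear implicits.

Section metric_entourages.
Context {R : realType} {X : metricType R}.

Definition ent_ball (e : R) : set (X * X) := [set p | mdist p.1 p.2 < e].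

Record metric_entourage := MetricEntourage {
  ent_set :> set (X * X);
  ent_setC : forall x y, ent_set (x, y) -> ent_set (y, x);
  ent_set_ball : exists2 e, 0 < e & ent_ball e `<=` ent_set }.

(* The supremum is +oo when all the ent_ball r are included in E, which
   happens for instance if X is bounded and E = setT. *)
Definition sigma (E : set (X * X)) : \bar R :=
  ereal_sup [set r%:E | r in [set r : R | 0 < r /\ ent_ball r `<=` E]].

Definition echain (E : set (X * X)) (s : seq X) : bool :=
  (s != [::]) && sorted (fun x y => (x, y) \in E) s.

Definition chained (E : set (X * X)) :=
  E `<=` closure E^° /\
  forall (x y : X) (F : metric_entourage), E (x, y) ->
    exists s, [/\ echain F s, head x s = x, last x s = y &
                  [set` s] `<=` xsection E x `&` xsection E y].

(* The second case is the convention that the chain {x, x} is identified with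
   {x}: it is not an instance of the first one, as both points of {x, x} are
   endpoints. *)
Definition insertion (s t : seq X) :=
  (exists a x c, [/\ a != [::], c != [::], s = a ++ c & t = a ++ x :: c]) \/
  (exists x, s = [:: x] /\ t = [:: x; x]).

Definition ehomotopic (E : set (X * X)) (s t : seq X) :=
  exists h : seq (seq X),
    [/\ all (echain E) (s :: h),
        path (fun u v => `[< insertion u v \/ insertion v u >]) s h &
        last s h = t].

(* Concatenation of chains such that t starts where s ends. *)
Definition ccat (s t : seq X) := s ++ behead t.

End metric_entourages.
Arguments metric_entourage {R} X.

Section homotopy_facts.
Context {R : realType} {X : metricType R}.
Implicit Types (s t u v : seq X) (E : metric_entourage X).

Lemma ent_refl E (x : X) : ent_set E (x, x).
Proof.
have [e e0] := ent_set_ball E; apply; rewrite /ent_ball /=.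
by have := ballxx x e0; rewrite ballEmdist.
Qed.

Lemma ehom_refl E s : echain E s -> ehomotopic E s s.
Proof. by move=> cs; exists [::]; rewrite /= cs. Qed.

Lemma ehom_trans E s t u :
  ehomotopic E s t -> ehomotopic E t u -> ehomotopic E s u.
Proof.
move=> [h [/= /andP[cs ch] ph <-]] [k [/= /andP[_ ck] pk <-]]; exists (h ++ k).
by rewrite last_cat /= all_cat cs ch ck cat_path ph pk.
Qed.

Lemma ehom_sym E s t : ehomotopic E s t -> ehomotopic E t s.
Proof.
move=> [h [ch ph <-]]; exists (rev (belast s h)); split.
- by rewrite -rev_rcons -lastI all_rev.
- rewrite rev_path; apply: sub_path ph => u v /asboolP uv.
  by apply/asboolP; case: uv; [right|left].
- by case: h {ch ph} => //= a h; rewrite rev_cons last_rcons.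
Qed.

Lemma ehom_step E s t : echain E s -> echain E t ->
  insertion s t \/ insertion t s -> ehomotopic E s t.
Proof.
move=> cs ct st; exists [:: t]; rewrite /= cs ct; split=> //; rewrite andbT.
exact/asboolP.
Qed.

Lemma insertion_ends s t x : insertion s t ->
  head x s = head x t /\ last x s = last x t.
Proof.
move=> [[[//|a0 a] [y [[//|c0 c] [_ _ -> ->]]]]|[y [-> ->]]] //=.
by rewrite !last_cat.
Qed.

Lemma ehom_lift E E' (f : seq X -> seq X) s t :
  (forall u v, echain E u -> echain E v -> insertion u v ->
    (forall x, head x u = head x s) -> (forall x, last x u = last x s) ->
    ehomotopic E' (f u) (f v)) ->
  (echain E s -> ehomotopic E' (f s) (f s)) ->
  ehomotopic E s t ->
  [/\ echain E s, echain E t, (forall x, head x s = head x t),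
      (forall x, last x s = last x t) & ehomotopic E' (f s) (f t)].
Proof.
move=> H fs [h [/= /andP[cs ch] ph <-]] {t}.
elim/last_ind: h ch ph => [|h t IH]; first by move=> _ _; split=> //; apply: fs.
rewrite all_rcons rcons_path last_rcons.
move=> /andP[ct /IH{}IH] /andP[/IH[_ cu hu lu fu] /asboolP st]; split=> //.
- by move=> x; rewrite hu; case: st => /(insertion_ends x)[].
- by move=> x; rewrite lu; case: st => /(insertion_ends x)[].
- apply: (ehom_trans fu); case: st => ins; first exact: H.
  apply: ehom_sym; apply: H => // x.
    by case: (insertion_ends x ins) => -> _; rewrite hu.
  by case: (insertion_ends x ins) => _ ->; rewrite lu.
Qed.

Lemma ehomP E s t : ehomotopic E s t ->
  [/\ echain E s, echain E t, (forall x, head x s = head x t) &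
      (forall x, last x s = last x t)].
Proof.
move=> st.
by have [] // := @ehom_lift E E id s t (fun u v cu cv i _ _ =>
  ehom_step cu cv (or_introl i)) (@ehom_refl E s) st.
Qed.

Lemma echain_rev E s : echain E s -> echain E (rev s).
Proof.
move=> /andP[s0 ss]; apply/andP; split; first by rewrite -size_eq0 size_rev size_eq0.
rewrite rev_sorted; apply: sub_sorted ss => x y /set_mem xy.
exact/mem_set/ent_setC.
Qed.

Lemma echain_ccat E s t x : echain E s -> echain E t ->
  last x s = head x t -> echain E (ccat s t).
Proof.
case: s t => [//|x0 s] [//|y0 t] /= ss st xy; rewrite /echain /= in ss st *.
by rewrite cat_path ss xy.
Qed.

Lemma rev_ccat s t x : s != [::] -> t != [::] -> last x s = head x t ->
  rev (ccat s t) = ccat (rev t) (rev s).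
Proof.
case/lastP: s => [//|s a] _; case: t => [//|b t] _; rewrite last_rcons /= => ->.
by rewrite /ccat rev_cat rev_cons rev_rcons /= -cats1 -catA.
Qed.

Lemma insertion_rev s t : insertion s t -> insertion (rev s) (rev t).
Proof.
move=> [[a [x [c [a0 c0 -> ->]]]]|[y [-> ->]]]; last by right; exists y.
left; exists (rev c), x, (rev a).
rewrite -!size_eq0 !size_rev !size_eq0 a0 c0 !rev_cat rev_cons.
by rewrite -cats1 -catA.
Qed.

Lemma ehom_rev E s t : ehomotopic E s t -> ehomotopic E (rev s) (rev t).
Proof.
move=> st; have [] // := @ehom_lift E E rev s t _ _ st.
  move=> u v cu cv uv _ _; apply: ehom_step; [exact: echain_rev..|].
  by left; exact: insertion_rev.
by move=> cs; apply/ehom_refl/echain_rev.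
Qed.

Lemma insertion_ccat s t u x : s != [::] -> insertion t u ->
  last x s = head x t -> insertion (ccat s t) (ccat s u).
Proof.
move=> s0 [[a [y [c [a0 c0 -> ->]]]]|[y [-> ->]]].
  case: a a0 => // a1 a _ /= _; left; exists (s ++ a), y, c.
  by rewrite /ccat /= !catA; split=> //; case: s s0.
case/lastP: s s0 => // s b _; rewrite last_rcons /ccat /= => ->; rewrite cats0.
case: s => [|s1 s]; first by right; exists y.
by left; exists (s1 :: s), y, [:: y]; rewrite -cats1 -catA.
Qed.

Lemma ehom_ccatr E s t u x : echain E s -> ehomotopic E t u ->
  last x s = head x t -> ehomotopic E (ccat s t) (ccat s u).
Proof.
move=> cs tu e; have [] // := @ehom_lift E E (ccat s) t u _ _ tu.
  move=> v w cv cw vw hv _.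
  have [ew _] := insertion_ends x vw.
  apply: ehom_step; [apply: (@echain_ccat _ _ _ x) => //..|].
  - by rewrite e hv.
  - by rewrite -ew e hv.
  - by left; apply: (@insertion_ccat _ _ _ x); rewrite ?e ?hv //; case/andP: cs.
by move=> ct; apply/ehom_refl/(@echain_ccat _ _ _ x).
Qed.

Lemma echain_neq0 E s : echain E s -> s != [::].
Proof. by case/andP. Qed.

Lemma head_rev s x : head x (rev s) = last x s.
Proof. by case/lastP: s => // s a; rewrite rev_rcons last_rcons. Qed.

Lemma last_rev s x : last x (rev s) = head x s.
Proof. by rewrite -head_rev revK. Qed.

Lemma ehom_ccatl E s t u x : echain E u -> ehomotopic E s t ->
  last x s = head x u -> ehomotopic E (ccat s u) (ccat t u).
Proof.
move=> cu st e; have [cs ct _ l] := ehomP st.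
rewrite -[ccat s u]revK -[ccat t u]revK; apply: ehom_rev.
rewrite (@rev_ccat _ _ x) ?(echain_neq0 cs) ?(echain_neq0 cu) //.
rewrite (@rev_ccat _ _ x) -?l ?(echain_neq0 ct) ?(echain_neq0 cu) //.
apply: (@ehom_ccatr _ _ _ _ x); [exact: echain_rev|exact: ehom_rev|].
by rewrite head_rev last_rev.
Qed.

Lemma last_ccat s t x : s != [::] -> t != [::] -> last x s = head x t ->
  last x (ccat s t) = last x t.
Proof. by case: s t => [//|a s] [//|b t] _ _ /=; rewrite last_cat => ->. Qed.

Lemma head_ccat s t x : s != [::] -> head x (ccat s t) = head x s.
Proof. by case: s. Qed.

Lemma ccatA s t u : t != [::] -> ccat (ccat s t) u = ccat s (ccat t u).
Proof. by case: t => // b t _; rewrite /ccat /= catA. Qed.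

Lemma ehom_dup E (x : X) : ehomotopic E [:: x] [:: x; x].
Proof.
apply: ehom_step => //; last by left; right; exists x.
by rewrite /echain /= andbT; apply/mem_set/ent_refl.
Qed.

Lemma ehom_cancel E s x : echain E s ->
  ehomotopic E (ccat (rev s) s) [:: last x s].
Proof.
case: s => [//|b s]; rewrite /ccat.
elim: s b => [|y s IH] b cs /=; first exact: ehom_refl.
have cs' : echain E (y :: s) by case/andP: cs => _ /= /andP[_].
have by_ : ent_set E (b, y) by case/andP: cs => _ /= /andP[/set_mem].
have c1 : echain E (ccat (rev (b :: y :: s)) (b :: y :: s)).
  apply: (@echain_ccat _ _ _ b) => //; first exact: echain_rev.
  by rewrite last_rev.
have c3 : echain E (ccat (rev (y :: s)) (y :: s)).
  apply: (@echain_ccat _ _ _ b) => //; first exact: echain_rev.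
  by rewrite last_rev.
have c2 : echain E (ccat (rev (y :: s)) (y :: y :: s)).
  apply: (@echain_ccat _ _ _ b); first exact: echain_rev.
    by case/andP: cs' => _ /= h; rewrite /echain /= h andbT; apply/mem_set/ent_refl.
  by rewrite last_rev.
apply: (@ehom_trans _ _ (ccat (rev (y :: s)) (y :: y :: s))).
  apply: ehom_step => //; right; left; exists (rev (y :: s)), b, (y :: s); split=> //.
    by rewrite -size_eq0 size_rev.
  by rewrite rev_cons cat_rcons.
apply: (@ehom_trans _ _ (ccat (rev (y :: s)) (y :: s))); last exact: IH.
apply: ehom_sym; apply: ehom_step => //; left; apply: (@insertion_ccat _ _ _ b).
- by rewrite -size_eq0 size_rev.
- case: s {IH cs cs' c1 c2 c3} => [|z s]; first by right; exists y.
  by left; exists [:: y], y, (z :: s).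
- by rewrite last_rev.
Qed.

End homotopy_facts.

Section ecover.
Context {R : realType} {X : metricType R} (b : X) (E : metric_entourage X).

Definition based_chain : Type :=
  {s : seq X | echain E s && (head b s == b)}.

HB.instance Definition _ := Choice.on based_chain.

Definition homotopic_based : rel based_chain :=
  fun s t => `[< ehomotopic E (val s) (val t) >].

Let homotopic_based_refl : reflexive homotopic_based.
Proof. by move=> s; apply/asboolP/ehom_refl; case/andP: (valP s). Qed.

Let homotopic_based_sym : symmetric homotopic_based.
Proof. by move=> s t; apply/idP/idP => /asboolP st; apply/asboolP/ehom_sym. Qed.

Let homotopic_based_trans : transitive homotopic_based.
Proof.
by move=> t s u /asboolP st /asboolP tu; apply/asboolP/(ehom_trans st).
Qed.

Canonical homotopic_based_equiv := EquivRel homotopic_based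
  homotopic_based_refl homotopic_based_sym homotopic_based_trans.

(* The space X_E. As quotients are taken on based chains, [s]_E is \pi s. *)
Definition ecover := {eq_quot homotopic_based_equiv}.

HB.instance Definition _ := Choice.on ecover.
HB.instance Definition _ := EqQuotient.on ecover.

Definition endpoint (s : based_chain) : X := last b (val s).

(* The projection phi_E; see cover_proj_pi below for its value on [s]_E. *)
Definition cover_proj (p : ecover) : X := endpoint (repr p).

Lemma cover_eqP (s t : based_chain) :
  (\pi_ecover s = \pi_ecover t) <-> ehomotopic E (val s) (val t).
Proof.
split=> [/eqquotP /asboolP //|st]; exact/eqquotP/asboolP.
Qed.

Lemma cover_proj_pi (s : based_chain) : cover_proj (\pi s) = endpoint s.
Proof.
have /cover_eqP/ehomP[_ _ _ l] : \pi_ecover (repr (\pi_ecover s)) = \pi s.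
  by rewrite reprK.
exact: l.
Qed.

(* F^*, for F contained in E *)
Definition star (F : set (X * X)) : set (ecover * ecover) :=
  [set p | exists s t : based_chain,
    [/\ p = (\pi_ecover s, \pi_ecover t), F (endpoint s, endpoint t) &
        ehomotopic E (ccat (rev (val s)) (val t))
                     [:: endpoint s; endpoint t]]].

(* The sets F^* are a base of a uniformity, whose topology has the balls
   B(p, F^* ) as a base of neighborhoods of p. *)
Definition cover_entourage : set_system (ecover * ecover) :=
  [set S | exists F : metric_entourage X, F `<=` E /\ star F `<=` S].

Let based_echain (s : based_chain) : echain E (val s).
Proof. by case/andP: (valP s). Qed.

Let based_head (s : based_chain) : head b (val s) = b.
Proof. by case/andP: (valP s) => _ /eqP. Qed.

Lemma subset_star (F G : set (X * X)) : F `<=` G -> star F `<=` star G.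
Proof. by move=> FG p [s [t [-> st h]]]; exists s, t; split=> //; exact: FG. Qed.

Lemma entourageI_subproof (F G : metric_entourage X) (x y : X) :
  (F `&` G) (x, y) -> (F `&` G) (y, x).
Proof. by move=> [Fxy Gxy]; split; exact: ent_setC. Qed.

Lemma entourageI_ball (F G : metric_entourage X) :
  exists2 e, 0 < e & @ent_ball _ X e `<=` F `&` G.
Proof.
have [e e0 eF] := ent_set_ball F; have [d d0 dG] := ent_set_ball G.
exists (Num.min e d); first by rewrite lt_min e0.
move=> p; rewrite /ent_ball /= lt_min => /andP[pe pd].
by split; [exact: eF|exact: dG].
Qed.

Definition entourageI (F G : metric_entourage X) : metric_entourage X :=
  MetricEntourage (@entourageI_subproof F G) (entourageI_ball F G).

Lemma ent_ball_entourage (e : R) : 0 < e ->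
  exists F : metric_entourage X, F = ent_ball e :> set _.
Proof.
move=> e0; have eC (x y : X) : ent_ball e (x, y) -> ent_ball e (y, x).
  by rewrite /ent_ball /= metric_sym.
have eB : exists2 d, 0 < d & @ent_ball _ X d `<=` ent_ball e by exists e.
by exists (MetricEntourage eC eB).
Qed.

Let cover_entourage_filter : Filter cover_entourage.
Proof.
split.
- by exists E; split.
- move=> S S' [F [FE FS]] [F' [FE' FS']]; exists (entourageI F F'); split.
    by apply: subset_trans FE => p [].
  move=> p pF; split; [apply: FS|apply: FS'];
    by apply: subset_star pF => q [].
- by move=> S S' SS' [F [FE FS]]; exists F; split=> //; exact: subset_trans SS'.
Qed.

Let cover_entourage_diagonal S :
  cover_entourage S -> diagonal `<=` S.
Proof.
move=> [F [_ FS]] [p q] pq; have {q pq}<- : p = q by exact: pq.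
apply: FS; rewrite -[p]reprK.
exists (repr p), (repr p); split=> //; first exact: ent_refl.
exact: ehom_trans (ehom_cancel b (based_echain _)) (ehom_dup _ _).
Qed.

Let cover_entourage_inv S :
  cover_entourage S -> cover_entourage (S^-1)%relation.
Proof.
move=> [F [FE FS]]; exists F; split=> // p [s [t [-> st h]]]; apply: FS.
exists t, s; split=> //; first exact: ent_setC.
move/ehom_rev : h; rewrite (@rev_ccat _ _ _ _ b) ?revK ?last_rev ?based_head //.
- by rewrite -size_eq0 size_rev size_eq0; exact: echain_neq0 (based_echain _).
- exact: echain_neq0 (based_echain _).
Qed.

Lemma star_comp (F G : set (X * X)) (p q r : ecover) : F `<=` E ->
  (forall x y z, G (x, y) -> G (y, z) -> F (x, z)) -> G `<=` E ->
  star G (p, q) -> star G (q, r) -> star F (p, r).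
Proof.
move=> FE GF GE [s [t [[-> ->] st hst]]] [t' [u [[tt' ->] tu htu]]].
have {}tt' : ehomotopic E (val t) (val t') by exact/cover_eqP.
have [_ _ _ /(_ b) ltt'] := ehomP tt'.
rewrite /endpoint -ltt' in tu htu.
have su := GF _ _ _ st tu.
exists s, u; split=> //.
have cs := based_echain s; have ct := based_echain t.
have ct' := based_echain t'; have cu := based_echain u.
have n0 (v : based_chain) : val v != [::] by exact: echain_neq0 (based_echain v).
have rn0 (v : based_chain) : rev (val v) != [::].
  by rewrite -size_eq0 size_rev size_eq0.
have hs := based_head s; have ht := based_head t.
have ht' := based_head t'; have hu := based_head u.
have crs := echain_rev cs; have crt := echain_rev ct.
have crt' := echain_rev ct'.
have c_tu : echain E (ccat (rev (val t)) (val u)).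
  by apply: (@echain_ccat _ _ _ _ _ b) => //; rewrite last_rev ht hu.
have c_st : echain E (ccat (rev (val s)) (val t)).
  by apply: (@echain_ccat _ _ _ _ _ b) => //; rewrite last_rev hs ht.
have e1 : ehomotopic E (ccat (rev (val t)) (val u))
    [:: last b (val t); endpoint u].
  apply: ehom_trans htu; apply: (@ehom_ccatl _ _ _ _ _ _ b) => //.
    exact: ehom_rev.
  by rewrite last_rev ht hu.
have e2 : ehomotopic E (ccat (ccat (rev (val s)) (val t)) (ccat (rev (val t)) (val u)))
    [:: endpoint s; endpoint t; endpoint u].
  apply: (@ehom_trans _ _ _ _
    (ccat (ccat (rev (val s)) (val t)) [:: endpoint t; endpoint u])).
    apply: (@ehom_ccatr _ _ _ _ _ _ b) => //.
    by rewrite last_ccat ?last_rev ?hs ?ht // head_ccat // head_rev.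
  have := @ehom_ccatl _ _ E _ _ [:: endpoint t; endpoint u] b _ hst.
  apply; first by rewrite /echain /= andbT; exact/mem_set/GE.
  by rewrite last_ccat ?last_rev ?hs ?ht.
have e3 : ehomotopic E [:: endpoint s; endpoint t; endpoint u]
    [:: endpoint s; endpoint u].
  apply: ehom_sym; apply: ehom_step.
  - by rewrite /echain /= andbT; exact/mem_set/FE.
  - by rewrite /echain /= andbT; apply/andP; split; exact/mem_set/GE.
  - by left; left; exists [:: endpoint s], (endpoint t), [:: endpoint u].
apply: ehom_trans (ehom_trans e2 e3); rewrite ccatA //.
apply: (@ehom_ccatr _ _ _ _ _ _ b) => //; last by rewrite last_rev hs hu.
rewrite -ccatA //.
have eu : val u = ccat [:: b] (val u).
  by move: hu (n0 u); rewrite /ccat; case: (val u) => //= x l ->.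
rewrite {1}eu.
apply: (@ehom_ccatl _ _ _ _ _ _ b) => //; apply: ehom_sym.
have := ehom_cancel b crt; rewrite revK last_rev ht.
by [].
Qed.

Let cover_entourage_split S : cover_entourage S ->
  exists2 S', cover_entourage S' & (S' \; S' `<=` S)%relation.
Proof.
move=> [F [FE FS]]; have [e e0 eF] := ent_set_ball F.
have [G GE] : exists G : metric_entourage X, G = ent_ball (e / 2) :> set _.
  by apply: ent_ball_entourage; rewrite divr_gt0.
have GF x y z : ent_set G (x, y) -> ent_set G (y, z) -> ent_set F (x, z).
  rewrite GE /ent_ball /= => xy yz; apply: eF; rewrite /ent_ball /=.
  by rewrite (le_lt_trans (metric_triangle _ y _))// [e]splitr ltrD.
have GsE : G `<=` E.
  by move=> [x y] xy; apply: FE; apply: (GF x x y) => //; exact: ent_refl.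
exists (star G); first by exists G; split.
by move=> [p r] [q /= pq qr]; apply: FS; exact: star_comp pq qr.
Qed.

HB.instance Definition _ := isUniform.Build ecover cover_entourage_filter
  cover_entourage_diagonal cover_entourage_inv cover_entourage_split.

End ecover.

Section NC.
Context {R : realType} {X : metricType R} (b : X).

Definition cover_equiv (E F : metric_entourage X) :=
  exists (f : ecover b E -> ecover b F) (g : ecover b F -> ecover b E),
    [/\ continuous f, continuous g, cancel f g, cancel g f &
        forall p, cover_proj (f p) = cover_proj p].

(* A cover phi_E is represented by the chained entourage E. *)
Definition entourage_covers (e : R) : set (metric_entourage X) :=
  [set E | chained E /\ (e%:E <= sigma E)%E].

Definition NC (e : R) : \bar R :=
  counting [set [set F | entourage_covers e F /\ cover_equiv E F] |
            E in entourage_covers e].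

End NC.

(* Main.v *)
(* Fix a finite r-net V of X, where r = e / 12, and for each x a point c x of V
   near x.  If E is chained and contains the 6r-ball entourage, each pair (x, y)
   of E is E-homotopic to x, c x, ..., c y, y, where the word c x ... c y has
   letters in V and small steps.  Removing its loops bounds its length by |V|.
   Substituting such words for the edges of an E-chain turns each elementary
   E-homotopy into an E-homotopy of words of length at most 2|V| + 1, so the
   finite set of pairs of E-homotopic words of that length determines
   E-homotopy between chains with small steps.  As every E-chain is E-homotopic
   to one with small steps, it determines the cover up to equivalence. *)
Require Import Defs.
From HB Require Import structures.
From mathcomp Require Import all_boot all_order all_algebra.
From mathcomp Require Import generic_quotient finmap lra.
From mathcomp Require Import boolp classical_sets cardinality reals ereal.
From mathcomp Require Import topology normedtype counting_measure.

Set Implicit Arguments.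
Unset Strict Implicit.
Unset Printing Implicit Defensive.
Import Order.TTheory GRing.Theory Num.Theory.
Local Open Scope classical_set_scope.
Local Open Scope ring_scope.
Local Open Scope quotient_scope.

(** * Elementary homotopies of chains *)

Section chains.
Context {R : realType} {X : metricType R}.
Implicit Types (E : metric_entourage X) (x y z a : X) (s t u : seq X).

Lemma echain_cons E x y s :
  echain E [:: x, y & s] = ((x, y) \in ent_set E) && echain E (y :: s).
Proof. by []. Qed.

Lemma echain_cat E x s t :
  echain E (x :: s ++ t) = echain E (x :: s) && echain E (last x s :: t).
Proof. by rewrite /echain /= cat_path. Qed.

Lemma ent_memC E x y : (x, y) \in ent_set E -> (y, x) \in ent_set E.
Proof. by rewrite !inE; exact: ent_setC. Qed.

Lemma ent_memxx E x : (x, x) \in ent_set E.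
Proof. by rewrite inE; exact: ent_refl. Qed.

Lemma ehom_echain E s t : ehomotopic E s t -> echain E s /\ echain E t.
Proof. by move=> /ehomP[]. Qed.

Lemma ehom_cat E x s t t' u : echain E (x :: s) ->
  ehomotopic E (last x s :: t) (last x s :: t') ->
  echain E (last (last x s) t :: u) ->
  ehomotopic E (x :: s ++ t ++ u) (x :: s ++ t' ++ u).
Proof.
move=> cs tt' cu.
have := @ehom_ccatl _ _ E _ _ (last (last x s) t :: u) x cu tt' erefl.
by move=> /(@ehom_ccatr _ _ E (x :: s) _ _ x cs); apply.
Qed.

Lemma ehom_catr E x t t' u : ehomotopic E (x :: t) (x :: t') ->
  echain E (last x t :: u) -> ehomotopic E (x :: t ++ u) (x :: t' ++ u).
Proof. exact: (@ehom_cat E x [::]). Qed.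

Lemma ehom_catl E x s t t' : echain E (x :: s) ->
  ehomotopic E (last x s :: t) (last x s :: t') ->
  ehomotopic E (x :: s ++ t) (x :: s ++ t').
Proof.
move=> cs tt'; rewrite -[t]cats0 -[t']cats0; exact: ehom_cat.
Qed.

Lemma ehom_cons E a x s t : (a, x) \in ent_set E ->
  ehomotopic E (x :: s) (x :: t) ->
  ehomotopic E [:: a, x & s] [:: a, x & t].
Proof. by move=> ax; apply: (@ehom_catl E a [:: x]); rewrite echain_cons ax. Qed.

Lemma ehom_ins E x y z s : (x, y) \in ent_set E -> (y, z) \in ent_set E ->
  (x, z) \in ent_set E -> echain E (z :: s) ->
  ehomotopic E [:: x, z & s] [:: x, y, z & s].
Proof.
move=> xy yz xz cs; apply: ehom_step; rewrite ?echain_cons ?xy ?yz ?xz //.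
by left; left; exists [:: x], y, (z :: s).
Qed.

Lemma ehom_back E x y : (x, y) \in ent_set E ->
  ehomotopic E [:: x] [:: x; y; x].
Proof.
move=> xy; apply: (ehom_trans (ehom_dup E x)).
by apply: ehom_ins => //; [exact: ent_memC|exact: ent_memxx].
Qed.

(** The whole chain is [E]-close to [x], so its points can be inserted one by one right behind [x],
    from the last back to the first. *)
Lemma ehom_fan E x p s y : echain E (p :: rcons s y) -> (x, y) \in ent_set E ->
  all (fun z => (x, z) \in ent_set E) (p :: s) ->
  ehomotopic E [:: x; y] [:: x, p & rcons s y].
Proof.
move=> + xy; elim: s p => [|q s IH] p cs /=.
  rewrite andbT => xp; apply: ehom_ins => //.
  by move: cs; rewrite /= echain_cons => /andP[].
move=> /andP[xp /andP[xq xs]].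
move: cs; rewrite rcons_cons echain_cons => /andP[pq cs].
apply: (ehom_trans (IH q cs _)); first by rewrite /= xq.
exact: ehom_ins.
Qed.

(** The two chains are the rails of a ladder with rungs [(f i, g i)] and diagonals [(f i, g j)].
    From the last rung backwards, each square is crossed by two triangle moves. *)
Lemma ehom_parallel (I : Type) (f g : I -> X) E i l :
  path (fun i j => [&& (f i, f j) \in ent_set E, (f i, g j) \in ent_set E &
                       (g i, g j) \in ent_set E]) i l ->
  all (fun i => (f i, g i) \in ent_set E) (i :: l) ->
  ehomotopic E (f i :: map f l)
               (f i :: g i :: rcons (map g l) (f (last i l))).
Proof.
elim: l i => [|j l IH] i; first by move=> _ /andP[? _]; exact: ehom_back.
move=> /andP[/and3P[ff fg gg] pl] /andP[fgi al].
have fgj : (f j, g j) \in ent_set E by case/andP: al.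
have h := IH j pl al.
have [_] := ehom_echain h; rewrite echain_cons => /andP[_ cg].
apply: (ehom_trans (ehom_cons ff h)).
apply: (ehom_trans (ehom_sym (ehom_ins ff fgj fg cg))).
exact: ehom_ins.
Qed.

Lemma ehom_conj E x y a s t : (x, a) \in ent_set E ->
  (last a s, y) \in ent_set E -> ehomotopic E (a :: s) (a :: t) ->
  ehomotopic E [:: x, a & rcons s y] [:: x, a & rcons t y].
Proof.
move=> xa ly st; apply: ehom_cons => //; rewrite -!cats1.
by apply: ehom_catr => //; rewrite echain_cons ly.
Qed.

(** The detours to [x] and to [y] surround [a :: s] by the conjugating points, so that [ehom_conjV]
    can exchange the conjugated chain inside. *)
Lemma ehom_pad E x y a s : echain E (a :: s) -> (x, a) \in ent_set E ->
  (last a s, y) \in ent_set E ->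
  ehomotopic E (a :: s) [:: a, x, a & rcons (rcons s y) (last a s)].
Proof.
move=> cs xa ly.
have h : ehomotopic E (a :: s) (a :: s ++ [:: y; last a s]).
  rewrite -{1}[s]cats0; apply: ehom_catl => //; exact: ehom_back.
apply: (ehom_trans h); rewrite -!cats1 -catA /=.
have [_ ch] := ehom_echain h.
have := ehom_catr (ehom_back (ent_memC xa)) ch; exact.
Qed.

Lemma ehom_conjV E x y a s t : echain E (a :: s) -> echain E (a :: t) ->
  (x, a) \in ent_set E -> (last a s, y) \in ent_set E ->
  last a s = last a t ->
  ehomotopic E [:: x, a & rcons s y] [:: x, a & rcons t y] ->
  ehomotopic E (a :: s) (a :: t).
Proof.
move=> cs ct xa ly st h; apply: (ehom_trans (ehom_pad cs xa ly)).
have lty : (last a t, y) \in ent_set E by rewrite -st.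
apply: ehom_trans (ehom_sym (ehom_pad ct xa lty)).
rewrite -st; apply: ehom_cons; first exact: ent_memC.
rewrite -!(cats1 (rcons _ y)); apply: (ehom_catr h) => /=.
by rewrite last_rcons echain_cons ent_memC.
Qed.

End chains.

(** * Words over a net *)

Section net.
Context {R : realType} {X : metricType R} (r : R) (V : seq X) (c : X -> X).
Context (cV : forall x, c x \in V) (cr : forall x, mdist x (c x) < r).
Implicit Types (E F : metric_entourage X) (x y z : X) (s t u : seq X).

(** Centres of points less than [r] apart satisfy this bound: [r] for the points and [r] for each
    centre. *)
Definition fine : rel X := fun x y => mdist x y < 3 * r.

(** The moves below only compare points at distance less than [5 * r], apart from pairs already
    known to be in [E]. *)
Definition coarse E := ent_ball (6 * r) `<=` ent_set E.

Definition edge_word E x y u :=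
  [/\ all (mem V) u, (size u <= size V)%N, path fine (c x) u,
      last (c x) u = c y & ehomotopic E [:: x; y] [:: x, c x & rcons u y]].

Lemma mdist_center x y : mdist (c x) (c y) < mdist x y + 2 * r.
Proof.
have := metric_triangle (c x) x (c y); have := metric_triangle x y (c y).
by have := cr x; have := cr y; rewrite [mdist (c x) x]metric_sym; lra.
Qed.

Lemma mdist_centerr x y : mdist x (c y) < mdist x y + r.
Proof. by have := metric_triangle x y (c y); have := cr y; lra. Qed.

Lemma r_gt0 x : 0 < r.
Proof. exact: le_lt_trans (mdist_ge0 _ _) (cr x). Qed.

Lemma coarse_near E x y : coarse E -> mdist x y < 6 * r ->
  (x, y) \in ent_set E.
Proof. by move=> Ec xy; apply/mem_set/Ec. Qed.

Lemma fine_coarse E x y : coarse E -> fine x y -> (x, y) \in ent_set E.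
Proof.
move=> Ec; rewrite /fine => xy; apply: coarse_near => //.
by have := r_gt0 x; lra.
Qed.

Lemma fine_echain E x s : coarse E -> path fine x s -> echain E (x :: s).
Proof.
move=> Ec; rewrite /echain /=; apply: sub_path => y z; exact: fine_coarse.
Qed.

Lemma center_near E x : coarse E -> (x, c x) \in ent_set E.
Proof.
by move=> Ec; apply: coarse_near => //; have := r_gt0 x; have := cr x; lra.
Qed.

(** Chainedness joins [x] to [y] by steps below [r] inside [B(x, E)]; the centres of this chain,
    with loops removed, form [u]. Each letter stays near a point of [B(x, E)]; these points form a
    chain fanned out from [x] and joined to [u] by a ladder. *)
Lemma edge_word_exists E x y : chained E -> coarse E -> ent_set E (x, y) ->
  exists u, edge_word E x y u.
Proof.
move=> [_ chE] Ec xy.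
have [F FE] := @ent_ball_entourage _ X r (r_gt0 x).
have [s [cs hs ls sE]] := chE x y F xy.
case: s => [//|x' s] /= in cs hs ls sE; rewrite {x'}hs in cs ls sE.
(* [Q v] puts the letter [v] within [r] of [B(x, E)]. Being part of the step relation [e], it
   survives the removal of loops. *)
pose Q v := `[< exists p, (x, p) \in ent_set E /\ mdist p v < r >].
pose e v w := [&& fine v w, Q v & Q w].
have Qc z : (x, z) \in ent_set E -> Q (c z).
  by move=> xz; apply/asboolP; exists z.
have sx : all (fun z => (x, z) \in ent_set E) (x :: s).
  by apply/allP => z /sE[]; rewrite /xsection /= !inE.
have pe : path e (c x) (map c s).
  rewrite path_map; apply: sub_in_path sx _ => [z t xz xt zt|]; last first.
    by case/andP: cs => _ /=; exact.
  rewrite /= /e !Qc // !andbT; have := mdist_center z t.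
  have : mdist z t < r by move/set_mem: zt; rewrite FE.
  by rewrite /fine; lra.
have : last (c x) (map c s) = c y by rewrite last_map ls.
(* Without loops the letters are distinct elements of [V], hence at most [size V] in number. *)
case/shortenP: pe => u pu uu su lu; exists u.
have uV v : v \in u -> v \in V by move=> /su /mapP[z _ ->].
(* [f v] is a point of [B(x, E)] near [v]; off [Q] its value is arbitrary. *)
have [f fP] : exists f : X -> X, forall v, Q v ->
    (x, f v) \in ent_set E /\ mdist (f v) v < r.
  have /choice : forall v, exists p, Q v -> (x, p) \in ent_set E /\ mdist p v < r.
    by move=> v; case: (asboolP (exists p, (x, p) \in ent_set E /\ mdist p v < r))
      => [[p]|]; [exists p|exists x => /asboolP].
  by move=> [f fP]; exists f.
split=> //.
- exact/allP.
- by apply: uniq_leq_size uV; case/andP: uu.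
- by apply: sub_path pu => v w /andP[].
have Qx : Q (c x) by apply/Qc/ent_memxx.
have Qu : all Q (c x :: u).
  rewrite /= Qx; apply/allP => v vu; move: pu.
  by case/splitPr: vu => u1 u2; rewrite cat_path /= => /and3P[_ /and3P[]].
have fV v w : Q v -> Q w -> fine v w ->
  [/\ mdist (f v) (f w) < 5 * r, mdist (f v) w < 4 * r & mdist v w < 3 * r].
  move=> /fP[_ vr] /fP[_ wr]; rewrite /fine => vw.
  have := metric_triangle (f v) v w; have := metric_triangle (f v) w (f w).
  by rewrite [mdist w _]metric_sym; split; lra.
have r0 := r_gt0 x.
have par := @ehom_parallel _ _ X f id E (c x) u.
have {}par : ehomotopic E (f (c x) :: map f u)
    (f (c x) :: c x :: rcons u (f (c y))).
  rewrite -lu -[u in rcons u _]map_id; apply: par.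
    apply: sub_path pu => v w /and3P[vw Qv Qw]; have [d1 d2 d3] := fV _ _ Qv Qw vw.
    by apply/and3P; split; apply: coarse_near => //; lra.
  apply: sub_all Qu => v /fP[_ vr]; apply: coarse_near => //=; lra.
have lastf : last (f (c x)) (map f u) = f (c y) by rewrite last_map lu.
have Qy : Q (c y) by apply/Qc/mem_set.
have fy : (f (c y), y) \in ent_set E.
  have [_ d] := fP _ Qy; apply: coarse_near => //.
  have := metric_triangle (f (c y)) (c y) y.
  by have := cr y; rewrite [mdist y _]metric_sym; lra.
have [cf _] := ehom_echain par.
have fan : ehomotopic E [:: x; y] [:: x, f (c x) & rcons (map f u) y].
  apply: ehom_fan.
  - by rewrite -cats1 echain_cat cf lastf echain_cons fy.
  - exact/mem_set.
  - rewrite -map_cons all_map; apply: sub_all Qu => v /fP[]//.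
apply: (ehom_trans fan).
have xf : (x, f (c x)) \in ent_set E by case: (fP _ Qx).
have conj := ehom_conj (y := y) xf _ par.
apply: (ehom_trans (conj _)); first by rewrite lastf.
have fc : (f (c x), c x) \in ent_set E.
  by have [_ ?] := fP _ Qx; apply: coarse_near => //; lra.
have [_ cp] := ehom_echain (conj ltac:(by rewrite lastf)).
move: cp; rewrite rcons_cons !echain_cons => /and3P[_ _ cp].
have xc := center_near x Ec.
(* Here [f (c x)] is removed between [x] and [c x]; then [f (c y)] is removed between [c y] and
   [y]. *)
apply: (ehom_trans (ehom_sym (ehom_ins xf fc xc cp))).
apply: ehom_cons => //; rewrite -!cats1 -catA /=; apply: ehom_catl.
  by apply: fine_echain => //; apply: sub_path pu => v w /andP[].
rewrite lu; apply: ehom_sym; apply: ehom_ins => //.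
  by have [_ d] := fP _ Qy; apply: coarse_near => //; rewrite metric_sym; lra.
exact/ent_memC/center_near.
Qed.

(** Each edge [(x, y)] gives way to [x], [c x], its edge word and [y], with all steps below
    [3 * r]. *)
Lemma echain_fine E s : chained E -> coarse E -> echain E s ->
  exists t, sorted fine t /\ ehomotopic E s t.
Proof.
move=> chE Ec; case: s => [//|x s].
suff : echain E (x :: s) ->
    exists t, path fine x t /\ ehomotopic E (x :: s) (x :: t).
  by move=> /[apply] -[t [pt ?]]; exists (x :: t).
elim: s x => [|y s IH] x; first by exists [::]; split=> //; exact: ehom_refl.
rewrite echain_cons => /andP[xy /IH[t [pt st]]].
have [u [_ _ pu lu eu]] := edge_word_exists chE Ec (set_mem xy).
exists (c x :: rcons u y ++ t).
have r0 := r_gt0 x.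
have xc z : fine z (c z) by rewrite /fine; have := cr z; lra.
split.
  rewrite /= xc cat_path rcons_path last_rcons pu lu pt /fine.
  by rewrite metric_sym; have := xc y; rewrite /fine => ->.
apply: (ehom_trans (ehom_cons xy st)).
by apply: (@ehom_catr _ _ E x [:: y] _ t eu) => /=; exact: fine_echain.
Qed.

(** The leading letter [c x] is left out, so that the words of consecutive edges concatenate without
    repeating a centre. *)
Fixpoint substitute (w : X -> X -> seq X) x s :=
  if s is y :: s' then w x y ++ substitute w y s' else [::].

Lemma substitute_cat w x s t :
  substitute w x (s ++ t) = substitute w x s ++ substitute w (last x s) t.
Proof. by elim: s x => //= y s IH x; rewrite IH catA. Qed.

(** * Transfer of homotopies from one entourage to another *)

Section transfer.
Context (E E' : metric_entourage X) (w : X -> X -> seq X).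
Context (Ec : coarse E) (E'c : coarse E').
Context (wP : forall x y, ent_set E (x, y) -> edge_word E x y (w x y)).
Context (EE' : forall u v, all (mem V) u -> all (mem V) v ->
  (size u <= (size V + size V).+1)%N -> (size v <= (size V + size V).+1)%N ->
  ehomotopic E u v -> ehomotopic E' u v).

Lemma substitute_fine x s : echain E (x :: s) ->
  path fine (c x) (substitute w x s) /\
  last (c x) (substitute w x s) = c (last x s).
Proof.
elim: s x => //= y s IH x; rewrite echain_cons => /andP[xy /IH[ps ls]].
have [_ _ pw lw _] := wP (set_mem xy).
by rewrite cat_path last_cat lw pw.
Qed.

(** Both sides are short words in [V], so by [EE'] an [E]-homotopy suffices; framed by [x] and [y],
    both are [E]-homotopic to [[:: x; y]]. *)
Lemma word_near x y : ent_set E (x, y) -> mdist x y < 3 * r ->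
  ehomotopic E' [:: c x, c y & [::]] (c x :: w x y).
Proof.
move=> xy d; have [wV sw pw lw ew] := wP xy; have r0 := r_gt0 x.
have ccd : mdist (c x) (c y) < 5 * r by have := mdist_center x y; lra.
apply: EE' => //.
- by rewrite /= !cV.
- by rewrite /= cV.
(* The word [[:: c x; c y]] respects the length bound because [V] is nonempty. *)
- by have := cV x; case: (V) => //= a V' _; rewrite addnS.
- by rewrite /= ltnS (leq_trans sw) ?leq_addr.
apply: (@ehom_conjV _ _ _ x y).
- by rewrite echain_cons (coarse_near Ec) //; lra.
- exact: fine_echain.
- exact: center_near.
- exact/ent_memC/center_near.
- by rewrite lw.
apply: ehom_trans ew; apply: ehom_sym.
have yc : (c y, y) \in ent_set E by exact/ent_memC/center_near.
apply: (@ehom_trans _ _ _ _ [:: x; c y; y]).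
  by apply: ehom_ins => //; [apply: coarse_near => //; have := mdist_centerr x y; lra
    |exact/mem_set].
apply: ehom_ins => //; first exact: center_near.
- by apply: coarse_near => //; lra.
- by apply: coarse_near => //; have := mdist_centerr x y; lra.
- by rewrite echain_cons yc.
Qed.

(** The longer side consists of [c x] and two edge words: this is the source of the bound
    [2|V| + 1]. By [EE'] it is enough to argue in [E], where [y] can be inserted between [x] and
    [z]. *)
Lemma word_triangle x y z : ent_set E (x, y) -> ent_set E (y, z) ->
  ent_set E (x, z) ->
  ehomotopic E' (c x :: w x z) (c x :: w x y ++ w y z).
Proof.
move=> xy yz xz; have [wV1 sw1 pw1 lw1 ew1] := wP xy.
have [wV2 sw2 pw2 lw2 ew2] := wP yz; have [wV3 sw3 pw3 lw3 ew3] := wP xz.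
have pw12 : path fine (c x) (w x y ++ w y z) by rewrite cat_path pw1 lw1.
apply: EE' => //.
- by rewrite /= cV.
- by rewrite /= cV all_cat wV1.
- by rewrite /= ltnS (leq_trans sw3) ?leq_addr.
- by rewrite /= ltnS size_cat leq_add.
apply: (@ehom_conjV _ _ _ x z); [exact: fine_echain..|exact: center_near|
  by rewrite lw3; exact/ent_memC/center_near|by rewrite last_cat lw1 lw2 lw3|].
apply: (ehom_trans (ehom_sym ew3)).
have h : ehomotopic E [:: x; z] [:: x; y; z] by apply: ehom_ins; rewrite ?inE.
apply: (ehom_trans h).
have e1 := @ehom_catr _ _ E x [:: y] _ [:: z] ew1.
apply: (ehom_trans (e1 _)); first by rewrite echain_cons mem_set.
have yE := center_near y Ec.
have cx : echain E [:: x, c x & w x y].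
  by rewrite echain_cons center_near //; exact: fine_echain.
have [_ c1] := ehom_echain (e1 ltac:(by rewrite echain_cons mem_set)).
have [_] := ehom_echain ew2; rewrite echain_cons => /andP[_ c2].
have -> : x :: (c x :: rcons (w x y) y) ++ [:: z] =
          x :: (c x :: w x y) ++ [:: y; z] by rewrite /= cat_rcons.
have -> : [:: x, c x & rcons (w x y ++ w y z) z] =
          x :: (c x :: w x y) ++ rcons (w y z) z by rewrite /= rcons_cat.
apply: ehom_catl => //=; rewrite lw1.
apply: (ehom_trans (ehom_cons (ent_memC yE) ew2)).
(* Only the backtrack [c y], [y], [c y] remains to be removed. *)
apply: ehom_sym.
have := @ehom_catr _ _ E (c y) [::] [:: y; c y] (rcons (w y z) z).
by apply=> //; apply: ehom_back; exact: ent_memC.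
Qed.

(** Inserting a point into an edge replaces one edge word by two, which is [word_triangle]; doubling
    a one-point chain is a case of [word_near]. *)
Lemma substitute_ehom x s y t : ehomotopic E (x :: s) (y :: t) ->
  ehomotopic E' (c x :: substitute w x s) (c y :: substitute w y t).
Proof.
pose f s := if s is x :: s' then c x :: substitute w x s' else [::].
move=> st; have [] // := @ehom_lift _ _ E E' f (x :: s) (y :: t) _ _ st; last first.
  by move=> /substitute_fine[ps _]; apply/ehom_refl/fine_echain.
move=> u v cu cv [[a [z [d [a0 d0 eu ev]]]]|[z [-> ->]]] _ _; last first.
  rewrite /= cats0; apply: ehom_trans (ehom_dup _ _) _.
  by apply: word_near; [exact: ent_refl|rewrite mdistxx mulr_gt0 //; exact: r_gt0 z].
rewrite {}eu {}ev in cu cv *.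
case: a a0 cu cv => // a1 a _; case: d d0 => // d1 d _.
rewrite !cat_cons !echain_cat !echain_cons => /and3P[ca ad cd] /and4P[_ az zd _].
rewrite /= !substitute_cat /=; have [pa la] := substitute_fine ca.
have [pd ld] := substitute_fine cd.
rewrite (catA (w _ z)).
apply: ehom_cat; first exact: fine_echain.
  by rewrite la; apply: word_triangle; exact: set_mem.
have [_ _ _ lw _] := wP (set_mem ad).
by rewrite la lw; exact: fine_echain.
Qed.

(** A ladder joins the chain to its centres, then [word_near] trades each step between centres for
    an edge word. *)
Lemma ehom_substitute x s : path fine x s ->
  ehomotopic E' (x :: s) [:: x, c x & rcons (substitute w x s) (last x s)].
Proof.
move=> ps; have r0 := r_gt0 x; have cs := fine_echain Ec ps.
have xc := center_near x E'c.
apply: (@ehom_trans _ _ _ _ [:: x, c x & rcons (map c s) (last x s)]).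
  have := @ehom_parallel _ _ X id c E' x s; rewrite map_id; apply.
    apply: sub_path ps => y z; rewrite /fine => yz.
    apply/and3P; split; apply: coarse_near => //; first lra.
      by have := mdist_centerr y z; lra.
    by have := mdist_center y z; lra.
  by apply/allP => z _; exact: center_near.
have mE : ehomotopic E' (c x :: map c s) (c x :: substitute w x s).
  elim: s x ps cs {r0 xc} => [|y s IH] x; first by move=> _ _; exact: ehom_refl.
  move=> /= /andP[xy ps]; rewrite echain_cons => /andP[Exy cs].
  have h1 := word_near (set_mem Exy) xy; have h2 := IH y ps cs.
  have [cxy _] := ehom_echain h1; have [_ cy] := ehom_echain h2.
  have := @ehom_catl _ _ E' (c x) [:: c y] _ _ cxy h2 => /ehom_trans; apply.
  exact: (@ehom_catr _ _ E' (c x) [:: c y] _ _ h1 cy).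
apply: ehom_conj => //; rewrite last_map; exact/ent_memC/center_near.
Qed.

(** In [E'] both chains are homotopic to their substituted words framed by the common endpoints, and
    [substitute_ehom] joins these words. *)
Lemma ehom_transfer s t : sorted fine s -> sorted fine t ->
  ehomotopic E s t -> ehomotopic E' s t.
Proof.
move=> ps pt st; have [cs ct h l] := ehomP st.
case: s cs ps h l st => [//|x s] cs ps h l st.
case: t ct pt h l st => [//|y t] ct pt /(_ x) /= xy /(_ x) /= l st.
rewrite -{y}xy in ct pt l st *.
apply: (ehom_trans (ehom_substitute ps)).
apply: ehom_trans (ehom_sym (ehom_substitute pt)).
rewrite -l; apply: ehom_conj (substitute_ehom st); first exact: center_near.
have [_ ->] := substitute_fine cs; exact/ent_memC/center_near.
Qed.

End transfer.
End net.

(** * Finite nets *)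

Lemma compact_net (R : realType) (X : metricType R) (b : X) (r : R) :
  compact [set: X] -> 0 < r -> exists (V : seq X) (c : X -> X),
    forall x, c x \in V /\ mdist x (c x) < r.
Proof.
(* The point [b] turns [X] into a pointed space, as [compact_cover] expects. *)
pose pX := isPointed.Build X b.
pose Xp : ptopologicalType := HB.pack (Metric.sort X) pX (Metric.class X).
move=> + r0; rewrite (compact_cover (Xp : ptopologicalType)) => cX.
have [||V _ VX] := cX X setT (fun x => (ball x r)^°).
- by move=> x _; exact: open_interior.
- by move=> x _; exists x => //; apply: nbhsx_ballx.
exists V.
have /choice[c cP] : forall x, exists v, v \in V /\ mdist x v < r.
  move=> x; have [v vV /interior_subset] := VX x I.
  by rewrite ballEmdist /= metric_sym; exists v.
by exists c.
Qed.

(** * Equivalence of covers through fine chains *)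

Section cover_equivalence.
Context {R : realType} {X : metricType R} (b : X).
Implicit Types E F G : metric_entourage X.

Lemma cover_equiv_trans E F G :
  cover_equiv b E F -> cover_equiv b F G -> cover_equiv b E G.
Proof.
move=> [f [g [fc gc fK gK fp]]] [f' [g' [fc' gc' fK' gK' fp']]].
exists (f' \o f), (g \o g'); split.
- by move=> p; apply: continuous_comp; [exact: fc|exact: fc'].
- by move=> p; apply: continuous_comp; [exact: gc'|exact: gc].
- exact: can_comp.
- exact: can_comp.
- by move=> p /=; rewrite fp' fp.
Qed.

Context (r : R).

(** Graph of the intended homeomorphism, sending the [E]-class of a fine chain to its [F]-class;
    totality and uniqueness, proved below, make it a map. *)
Definition fine_rel E F (p : ecover b E) (q : ecover b F) :=
  exists (s : based_chain b E) (t : based_chain b F),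
    [/\ val s = val t :> seq X, sorted (fine r) (val s),
        p = \pi_(ecover b E) s & q = \pi_(ecover b F) t].

Lemma fine_rel_sym E F p q : @fine_rel E F p q -> @fine_rel F E q p.
Proof. by move=> [s [t [st fs -> ->]]]; exists t, s; rewrite -st. Qed.

Definition fine_dense E :=
  forall s, echain E s -> exists t, sorted (fine r) t /\ ehomotopic E s t.

Definition fine_transfer E F := forall s t, sorted (fine r) s ->
  sorted (fine r) t -> ehomotopic E s t -> ehomotopic F s t.

Lemma fine_rel_total E F : fine_dense E -> fine_transfer E F ->
  forall p, exists q, @fine_rel E F p q.
Proof.
move=> dE EF p; have /andP[cs /eqP hs] := valP (repr p).
have [t [ft st]] := dE _ cs; have [_ ct ht _] := ehomP st.
have [_ ct' _ _] := ehomP (EF _ _ ft ft (ehom_refl ct)).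
have htb : head b t == b by rewrite -ht hs.
have tE : echain E t && (head b t == b) by rewrite ct.
have tF : echain F t && (head b t == b) by rewrite ct'.
exists (\pi_(ecover b F) (exist _ t tF)), (exist _ t tE), (exist _ t tF).
by split=> //; rewrite -[p]reprK; exact/cover_eqP.
Qed.

Lemma fine_rel_fun E F p q q' : fine_transfer E F ->
  @fine_rel E F p q -> @fine_rel E F p q' -> q = q'.
Proof.
move=> EF [s [t [st fs -> ->]]] [s' [t' [st' fs' /cover_eqP ss' ->]]].
by apply/cover_eqP; rewrite -st -st'; exact: EF.
Qed.

Lemma fine_rel_proj E F p q : @fine_rel E F p q -> cover_proj q = cover_proj p.
Proof.
by move=> [s [t [st _ -> ->]]]; rewrite !cover_proj_pi /endpoint st.
Qed.

(** Close points of the cover are represented by fine chains. Once their endpoints are less than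
    [3 * r] apart, both chains in the homotopy defining [star] are fine, so it transfers to [F]. *)
Lemma fine_rel_continuous E F (f : ecover b E -> ecover b F) :
  0 < r -> coarse r E -> coarse r F -> fine_transfer E F ->
  (forall p, fine_rel p (f p)) -> continuous f.
Proof.
move=> r0 Ec Fc EF fP p A /nbhsP[S [G [GF GS]] SA].
have r3 : 0 < 3 * r by lra.
have [D DE] := @ent_ball_entourage _ X (3 * r) r3.
have DF (H : metric_entourage X) : coarse r H -> D `<=` ent_set H.
  by move=> Hc xy; rewrite DE => d; apply: Hc; move: d; rewrite /ent_ball /=; lra.
apply/nbhsP; exists (star (entourageI G D)).
  exists (entourageI G D); split=> // xy [_ /DF]; exact.
move=> q; rewrite /xsection /= inE => -[s [t [[ep eq] [Gst Dst] st]]].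
apply: SA; rewrite {}ep {}eq /xsection /= inE; apply: GS.
have [s1 [s2 [s12 fs ss1 ->]]] := fP (\pi s).
have [t1 [t2 [t12 ft tt1 ->]]] := fP (\pi t).
move: ss1 tt1 => /cover_eqP ss1 /cover_eqP tt1.
exists s2, t2.
have [cs cs1 hss1 lss1] := ehomP ss1; have [ct ct1 htt1 ltt1] := ehomP tt1.
have es : endpoint s2 = endpoint s by rewrite /endpoint -s12 lss1.
have et : endpoint t2 = endpoint t by rewrite /endpoint -t12 ltt1.
rewrite es et -s12 -t12; split=> //.
have /andP[_ /eqP hs] := valP s; have /andP[_ /eqP ht] := valP t.
have h : ehomotopic E (ccat (rev (val s1)) (val t1)) [:: endpoint s; endpoint t].
  apply: ehom_trans st.
  apply: (@ehom_trans _ _ _ _ (ccat (rev (val s1)) (val t))).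
    apply: (@ehom_ccatr _ _ _ _ _ _ b); [exact: echain_rev|exact: ehom_sym|].
    by rewrite last_rev -hss1 -htt1 hs ht.
  apply: (@ehom_ccatl _ _ _ _ _ _ b) => //; first exact/ehom_rev/ehom_sym.
  by rewrite last_rev -hss1 hs ht.
apply: EF h; last first.
  by rewrite /= andbT; have := Dst; rewrite DE.
have frs : sorted (fine r) (rev (val s1)).
  by rewrite rev_sorted; apply: sub_sorted fs => x y; rewrite /fine metric_sym.
have : last b (rev (val s1)) = head b (val t1).
  by rewrite last_rev -hss1 -htt1 hs ht.
move: frs ft; rewrite /ccat; case: (rev _) => [|x u] /=.
  by move=> _; case: (val t1) => //= y v /path_sorted.
by move=> pu; case: (val t1) => //= [|y v pv l]; rewrite ?cats0 // cat_path pu l.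
Qed.

Lemma fine_cover_equiv E F : 0 < r -> coarse r E -> coarse r F ->
  fine_dense E -> fine_dense F -> fine_transfer E F -> fine_transfer F E ->
  cover_equiv b E F.
Proof.
move=> r0 Ec Fc dE dF EF FE.
have [f fP] := choice (fine_rel_total dE EF).
have [g gP] := choice (fine_rel_total dF FE).
exists f, g; split.
- exact: fine_rel_continuous fP.
- exact: fine_rel_continuous gP.
(* [p] and [g (f p)] are both related to [f p], hence equal. *)
- move=> p; apply: (fine_rel_fun FE (gP (f p))); exact: fine_rel_sym.
- move=> p; apply: (fine_rel_fun EF (fP (g p))); exact: fine_rel_sym.
- by move=> p; exact: fine_rel_proj.
Qed.

End cover_equivalence.

(** * A finite invariant of entourages *)

Section code.
Context {R : realType} {X : metricType R} (V : seq X).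

(** Bounded sequences over the finite type of points of [V] form a finite type, so [word_code] takes
    finitely many values. *)
Definition words := ((size V + size V).+1).-bseq (seq_sub V).

HB.instance Definition _ := Finite.on words.

Definition word_code (E : metric_entourage X) : {set words * words} :=
  [set p : words * words | `[< ehomotopic E (map val p.1) (map val p.2) >]].

Lemma wordsP (u : seq X) : all (mem V) u ->
  (size u <= (size V + size V).+1)%N -> exists v : words, map val v = u.
Proof.
move=> uV su.
have e : map val (pmap insub u : seq (seq_sub V)) = u.
  rewrite (pmap_filter (insubK _)); apply/all_filterP; apply: sub_all uV => x xV.
  by rewrite isSome_insub.
have sv : (size (pmap insub u : seq (seq_sub V)) <= (size V + size V).+1)%N.
  by rewrite -(size_map val) e.
by exists (Bseq sv).
Qed.

Lemma word_code_ehom E F u v : word_code E = word_code F ->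
  all (mem V) u -> all (mem V) v ->
  (size u <= (size V + size V).+1)%N -> (size v <= (size V + size V).+1)%N ->
  ehomotopic E u v -> ehomotopic F u v.
Proof.
move=> EF uV vV su sv; have [u' <-] := wordsP uV su; have [v' <-] := wordsP vV sv.
move=> h; have : (u', v') \in word_code F by rewrite -EF inE; exact/asboolP.
by rewrite inE => /asboolP.
Qed.

End code.

(** * Finiteness of the set of classes *)

Lemma sigma_coarse (R : realType) (X : metricType R) (E : metric_entourage X)
    (e r : R) : (e%:E <= sigma E)%E -> 6 * r < e -> coarse r E.
Proof.
move=> eE re; have /ereal_sup_gt[_ [d [_ dE] <-]] : ((6 * r)%:E < sigma E)%E.
  by apply: lt_le_trans eE; rewrite lte_fin.
by rewrite lte_fin => rd [x y] xy; apply: dE; exact: lt_trans rd.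
Qed.

Lemma word_code_transfer (R : realType) (X : metricType R) (r : R) (V : seq X)
    (c : X -> X) (E F : metric_entourage X) :
  (forall x, c x \in V) -> (forall x, mdist x (c x) < r) ->
  chained E -> coarse r E -> coarse r F -> word_code V E = word_code V F ->
  fine_transfer r E F.
Proof.
move=> cV cr chE Ec Fc EF.
(* Pairs outside [E] get the empty word, so that choice yields a total function. *)
have wex (p : X * X) : exists u, ent_set E p -> edge_word r V c E p.1 p.2 u.
  case: p => x y; case: (pselect (ent_set E (x, y))) => [xy|]; last by exists [::].
  by have [u ?] := edge_word_exists cV cr chE Ec xy; exists u.
have [w wP] := choice wex.
move=> s t; apply: (@ehom_transfer _ _ r V c cV cr E F (fun x y => w (x, y))) => //.
  by move=> x y /wP.
by move=> u v uV vV su sv; exact: word_code_ehom EF uV vV su sv.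
Qed.

Theorem corollary2 (R : realType) (X : metricType R) (b : X) (e : R) :
  peano_continuum R X -> 0 < e -> (NC b e < +oo)%E.
Proof.
(* Then [6 * r = e / 2 < e], and [sigma_coarse] applies to every entourage counted. *)
move=> [cX _ _] e0; pose r := e / 12.
have r0 : 0 < r by rewrite /r; lra.
have [V [c cP]] := compact_net b cX r0.
have cV x : c x \in V by case: (cP x).
have cr x : mdist x (c x) < r by case: (cP x).
have code_equiv E F : entourage_covers e E -> entourage_covers e F ->
    word_code V E = word_code V F -> cover_equiv b E F.
  move=> [chE sE] [chF sF] EF.
  have r6 : 6 * r < e by rewrite /r; lra.
  have Ec := sigma_coarse sE r6; have Fc := sigma_coarse sF r6.
  apply: (@fine_cover_equiv _ _ b r) => //.
  - move=> s; exact: (echain_fine cV cr).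
  - move=> s; exact: (echain_fine cV cr).
  - exact: (word_code_transfer cV cr).
  - by apply: (word_code_transfer cV cr) => //; exact/esym.
(* [counting] is a finite number on finite sets, so finiteness of the set of classes remains. *)
rewrite /NC /counting asboolT ?ltry //.
pose cls (E : metric_entourage X) :=
  [set F | entourage_covers e F /\ cover_equiv b E F].
(* [D k] is the union of the classes of entourages with code [k]. By [code_equiv] the class of [E]
   equals [D (word_code V E)], so the classes lie in the image of a finite set. *)
pose D (k : {set words V * words V}) :=
  [set F | exists E, [/\ entourage_covers e E, word_code V E = k & cls E F]].
apply: (@sub_finite_set _ _ [set D k | k in setT]); last exact/finite_image/finite_finset.
move=> _ [E EC <-]; exists (word_code V E) => //.
apply/seteqP; split=> F.
  move=> [E' [E'C E'E [FC E'F]]]; split=> //.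
  by apply: cover_equiv_trans E'F; apply: code_equiv.
by move=> EF; exists E.
Qed.
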